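(* Let $m,n\ge1$ be integers. In the $(m+1)$-round classical bit commitment protocol described in the context, if Bob is honest then the protocol is $\varepsilon$-binding against classical Alice with $\varepsilon=\omega_m$: for every classical strategy of dishonest Alice respecting the causal constraints, the probabilities $p_0,p_1$ that Bob accepts the opening of $0$, respectively $1$, satisfy $$p_0+p_1\le 1+\omega_m,$$ where $\omega_m$ is the classical value of the $m$-player game over $\mathbb{F}_{2^n}$ defined in the context.
   Context: All $n$-bit strings are identified with elements of the finite field $\mathbb{F}_{2^n}$; $\oplus$ is addition (bitwise XOR) and $*$ is multiplication in $\mathbb{F}_{2^n}$; for a bit $d$ and a string $y$, $d\cdot y$ equals $0$ if $d=0$ and $y$ if $d=1$. Protocol with honest Bob. Bob's strings $B_1,\dots,B_m$ are independent and uniform on $\mathbb{F}_{2^n}$ and independent of Alice's randomness $R_A$. In round $k$ ($1\le k\le m$) Bob sends $B_k$ and Alice replies with $X_k\in\mathbb{F}_{2^n}$; in round $m+1$ Alice announces $d$ and a string $X_{m+1}\in\mathbb{F}_{2^n}$. Bob accepts the opening of $d$ iff $$X_{m+1}=X_m\oplus B_m*X_{m-1}\oplus B_m*B_{m-1}*X_{m-2}\oplus\cdots\oplus B_m*B_{m-1}*\cdots*B_2*X_1\oplus d\cdot(B_m*B_{m-1}*\cdots*B_1).$$ Dishonest classical Alice. Consecutive rounds are space-like separated (rounds alternate between two distant locations), and the bit $d$ that Alice is challenged to open is known to her agents in every round except the first. A strategy consists of a random variable $R_A$ (shared randomness, with values in a finite set) and deterministic functions such that $$X_1=f_1(R_A,B_1),\qquad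 X_k=f_k(R_A,B_1,\dots,B_{k-2},B_k,d)\ (2\le k\le m),\qquad X_{m+1}=f_{m+1}(R_A,B_1,\dots,B_{m-1},d).$$ $p_d$ is the probability, over $R_A$ and $B_1,\dots,B_m$, that Bob accepts when $d$ is opened with this strategy. The game. For independent uniform $Z_1,\dots,Z_m$ on $\mathbb{F}_{q}$ with $q=2^n$, $$\omega_m:=\max_{h_1,\dots,h_m}\Pr\Big[\prod_{k=1}^m Z_k=\sum_{k=1}^m h_k\big((Z_j)_{j\ne k}\big)\Big],$$ with arithmetic in $\mathbb{F}_q$ and the maximum over all functions $h_k:\mathbb{F}_q^{m-1}\to\mathbb{F}_q$ (constants if $m=1$). *)

(* Defs.v *)
From mathcomp Require Import all_boot all_order all_algebra.

Set Implicit Arguments.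
Unset Strict Implicit.
Unset Printing Implicit Defensive.

Import Order.TTheory GRing.Theory Num.Theory.
Local Open Scope ring_scope.

Definition uniform_prob (R : realFieldType) (T : finType) (E : {set T}) : R :=
  #|E|%:R / #|T|%:R.

(* Rounds are numbered from 1, as in the protocol: for 1 <= k <= m, [at_round B k]
   is B_k. The default value 0 is reached only outside that range. *)
Definition at_round (F : finFieldType) (m : nat) (B : m.-tuple F) (k : nat) : F :=
  nth 0 B k.-1.

(* (B_1, ..., B_l), used only for l <= m. *)
Definition first_rounds (F : finFieldType) (m : nat) (B : m.-tuple F) (l : nat) :
    l.-tuple F :=
  [tuple at_round B j.+1 | j < l].

(* The causal constraints are carried by the types: [first_msg] receives B_1 and
   not d; [mid_msg k] is the function f_k, used only for 2 <= k <= m, and receives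
   (B_1, ..., B_(k-2)), B_k and d; [last_msg] is f_(m+1) and receives
   (B_1, ..., B_(m-1)) and d. *)
Record strategy (R : realFieldType) (F : finFieldType) (m : nat) := Strategy {
  randomness : finType;
  law : randomness -> R;
  law_ge0 : forall r, 0 <= law r;
  law_sum1 : \sum_r law r = 1;
  first_msg : randomness -> F -> F;
  mid_msg : forall k : nat, randomness -> (k - 2).-tuple F -> F -> bool -> F;
  last_msg : randomness -> (m - 1).-tuple F -> bool -> F
}.

Section Protocol.
Variables (R : realFieldType) (F : finFieldType) (m : nat).
Implicit Types (S : strategy R F m) (B : m.-tuple F) (d : bool).

(* X_k for 1 <= k <= m. *)
Definition reply S (r : randomness S) B d (k : nat) : F :=
  if k == 1%N then first_msg r (at_round B 1)
  else mid_msg r (first_rounds B (k - 2)) (at_round B k) d.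

(* X_(m+1). *)
Definition opening S (r : randomness S) B d : F :=
  last_msg r (first_rounds B (m - 1)) d.

(* Bob's test, with X k standing for X_k and Y for X_(m+1). *)
Definition accepts B (X : nat -> F) (Y : F) d : bool :=
  Y == \sum_(1 <= k < m.+1) (\prod_(k.+1 <= j < m.+1) at_round B j) * X k
       + (if d then \prod_(1 <= j < m.+1) at_round B j else 0).

(* R_A and (B_1, ..., B_m) are independent, the latter uniform on F^m. *)
Definition accept_prob S d : R :=
  \sum_(r : randomness S)
    law r * uniform_prob R [set B | accepts B (reply r B d) (opening r B d) d].

Definition binding (eps : R) : Prop :=
  forall S, accept_prob S false + accept_prob S true <= 1 + eps.

(* [h k] is applied to the values Z_j with j != k, listed in increasing order
   of j. *)
Definition game_won (h : {ffun 'I_m -> {ffun (m.-1).-tuple F -> F}})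
    (Z : m.-tuple F) : bool :=
  \prod_(k < m) tnth Z k == \sum_(k < m) h k [tuple tnth Z (lift k j) | j < m.-1].

(* The probabilities are nonnegative and the index type is nonempty, so starting
   from 0 yields the maximum. *)
Definition game_value : R :=
  \big[Num.max/0]_(h : {ffun 'I_m -> {ffun (m.-1).-tuple F -> F}})
    uniform_prob R [set Z | game_won h Z].

End Protocol.

(* Main.v *)
(** Fix Alice's randomness. The two acceptance events have total probability at
    most 1 plus the probability that both hold. If both hold, subtract Bob's two
    tests: [X_1] cancels since it does not see [d], and what remains expresses
    [B_m * ... * B_1] as a sum of the terms
    [B_m * ... * B_(k+1) * (X_k^0 - X_k^1)], 2 <= k <= m, which do not involve
    [B_(k-1)], and of [X_(m+1)^1 - X_(m+1)^0], which does not involve [B_m]. These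
    are winning answers of players 1, ..., m in the game. *)
Require Import Defs.
From mathcomp Require Import all_boot all_order all_algebra.
From mathcomp Require Import ring.

Import Order.TTheory GRing.Theory Num.Theory.
Local Open Scope ring_scope.

(** Independence from coordinate [k] is expressed as invariance under [zero_at k]. *)
Definition zero_at {F : finFieldType} {m : nat} (k : 'I_m) (B : m.-tuple F) :
    m.-tuple F :=
  [tuple if j == k then 0 else tnth B j | j < m].

Lemma at_round_zero_at (F : finFieldType) (m : nat) (k : 'I_m) (B : m.-tuple F)
    (j : nat) : (0 < j)%N -> j != k.+1 -> at_round (zero_at k B) j = at_round B j.
Proof.
case: j => // j _; rewrite eqSS /at_round => jk.
have [jm|mj] := ltnP j m; last by rewrite !nth_default ?size_tuple.
rewrite -(tnth_nth 0 _ (Ordinal jm)) -(tnth_nth 0 _ (Ordinal jm)) tnth_mktuple.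
by rewrite -val_eqE /= (negbTE jk).
Qed.

Lemma first_rounds_zero_at (F : finFieldType) (m : nat) (k : 'I_m)
    (B : m.-tuple F) (l : nat) :
  (l <= k)%N -> first_rounds (zero_at k B) l = first_rounds B l.
Proof.
move=> lk; apply: eq_mktuple => j; rewrite at_round_zero_at // eqSS.
by rewrite ltn_eqF // (leq_trans (ltn_ord j)).
Qed.

Lemma prod_at_round (F : finFieldType) (m : nat) (B : m.-tuple F) :
  \prod_(1 <= j < m.+1) at_round B j = \prod_(k < m) tnth B k.
Proof.
by rewrite big_add1 /= big_mkord; apply: eq_bigr => i _; rewrite (tnth_nth 0).
Qed.

(** Each [g k] is determined by the coordinates other than [k]: refilling the gap with 0 turns [g]
    into a family of answers that wins on all of [E]. *)
Lemma uniform_prob_le_game_value (R : realFieldType) (F : finFieldType) (m : nat)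
    (E : {set m.-tuple F}) (g : 'I_m -> m.-tuple F -> F) :
  (forall k B, g k (zero_at k B) = g k B) ->
  {in E, forall B, \prod_(k < m) tnth B k = \sum_(k < m) g k B} ->
  uniform_prob R E <= game_value R F m.
Proof.
move=> g_indep gE.
pose fill k (t : (m.-1).-tuple F) : m.-tuple F :=
  [tuple if unlift k j is Some i then tnth t i else 0 | j < m].
pose h := [ffun k : 'I_m => [ffun t => g k (fill k t)]].
apply: le_trans (le_bigmax _ _ h).
rewrite ler_wpM2r ?invr_ge0 ?ler0n // ler_nat subset_leq_card //.
apply/subsetP => B BE; rewrite inE /game_won gE //; apply/eqP/eq_bigr => k _.
rewrite !ffunE -g_indep; congr (g k _); apply: eq_mktuple => j.
by case: unliftP => [i|] ->; rewrite ?eqxx // tnth_mktuple eq_sym (negbTE (neq_lift _ _)).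
Qed.

Section BothOpenings.
Variables (R : realFieldType) (F : finFieldType) (m : nat).
Variables (S : strategy R F m.+1) (r : randomness S).

Definition accepted (d : bool) : {set m.+1.-tuple F} :=
  [set B | accepts B (reply r B d) (opening r B d) d].

(* Players are indexed from 0: player [k] misses [B_(k+1)] and answers with the
   contribution of the message of round [k+2]. *)
Definition answer (k : 'I_m.+1) (B : m.+1.-tuple F) : F :=
  if (k < m)%N then
    (\prod_(k.+3 <= j < m.+2) at_round B j)
      * (reply r B false k.+2 - reply r B true k.+2)
  else opening r B true - opening r B false.

(** The reply of round [k+2] reads only [B_1, ..., B_k] and [B_(k+2)], and its coefficient starts at
    [B_(k+3)]; the opening misses [B_(m+1)], the last string here. *)
Lemma answer_zero_at (k : 'I_m.+1) (B : m.+1.-tuple F) :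
  answer k (zero_at k B) = answer k B.
Proof.
rewrite /answer; case: ltnP => km; last first.
  by rewrite /opening first_rounds_zero_at // subn1.
rewrite /reply /= first_rounds_zero_at ?subn2 // at_round_zero_at //; last first.
  by rewrite eqSS gtn_eqF.
congr (_ * _); apply: eq_big_nat => j /andP[kj _].
by rewrite at_round_zero_at ?gtn_eqF ?(leq_trans _ kj).
Qed.

Lemma sum_answer (B : m.+1.-tuple F) :
  B \in accepted false :&: accepted true ->
  \prod_(k < m.+1) tnth B k = \sum_(k < m.+1) answer k B.
Proof.
rewrite !inE /accepts prod_at_round addr0 => /andP[/eqP op0 /eqP op1].
rewrite [RHS]big_ord_recr /= [answer ord_max B]/answer ltnn op0 op1.
(* Round 1 is split off from both sums: its reply ignores [d], so [ring] cancels it. *)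
rewrite [X in _ + (X + _ - _)]big_ltn // [X in _ + (_ - X)]big_ltn //.
rewrite !big_add1 /= !big_mkord.
rewrite (eq_bigr (fun k : 'I_m =>
    (\prod_(k.+3 <= j < m.+2) at_round B j) * reply r B false k.+2 -
    (\prod_(k.+3 <= j < m.+2) at_round B j) * reply r B true k.+2)); last first.
  by move=> k _; rewrite /answer /= ltn_ord mulrBr.
rewrite sumrB [reply r B true 1]/reply [reply r B false 1]/reply /=.
ring.
Qed.

Lemma both_accepted_le :
  uniform_prob R (accepted false) + uniform_prob R (accepted true) <=
  1 + game_value R F m.+1.
Proof.
have total_neq0 : #|{: m.+1.-tuple F}|%:R != 0 :> R.
  by rewrite pnatr_eq0 -lt0n; apply/card_gt0P; exists [tuple 0 | _ < m.+1].
(* Inclusion-exclusion: the union contributes at most 1. *)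
rewrite /uniform_prob -mulrDl -natrD -cardsUI natrD mulrDl lerD //.
  by rewrite ler_pdivrMr ?mul1r ?ler_nat ?max_card // lt0r total_neq0 ler0n.
exact: uniform_prob_le_game_value answer_zero_at sum_answer.
Qed.

End BothOpenings.

Theorem proposition6p2 (R : realFieldType) (m n : nat) (hm : (1 <= m)%N)
    (hn : (1 <= n)%N) (F : finFieldType) (hF : #|F| = (2 ^ n)%N) :
  binding F m (game_value R F m).
Proof.
case: m hm => // m _ S; rewrite /accept_prob -big_split /=.
(* Writing the bound as its own average under [law] reduces the claim to a fixed [r]. *)
rewrite -[X in _ <= X]mul1r -[X in _ <= X * _](law_sum1 S) mulr_suml.
apply: ler_sum => r _; rewrite -mulrDr ler_wpM2l ?law_ge0 //.
exact: both_accepted_le.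
Qed.
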